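(* Let $1\le k\le n-2$ and let $G$ be a strongly connected simple digraph on $n$ vertices with arc connectivity $k$ and with $\delta^0(G)=k$. Then: (i) if $\alpha=0$, $\lambda_\alpha(G)\le\lambda_\alpha(K(n,k,1))=\lambda_\alpha(K(n,k,n-k-1))$, with equality if and only if $G\cong K(n,k,n-k-1)$ or $G\cong K(n,k,1)$; (ii) if $0<\alpha<1$, $\lambda_\alpha(G)\le\lambda_\alpha(K(n,k,n-k-1))$, with equality if and only if $G\cong K(n,k,n-k-1)$.
   Context: For a simple digraph $G$, $A(G)$ is the adjacency matrix, $D(G)$ the diagonal matrix of outdegrees, $A_\alpha(G)=\alpha D(G)+(1-\alpha)A(G)$, and $\lambda_\alpha(G)$ is the largest modulus of the eigenvalues of $A_\alpha(G)$. Strongly connected: for every ordered pair of vertices there is a directed path from the first to the second. The arc connectivity of a strongly connected digraph is the minimum number of arcs whose deletion yields a digraph that is not strongly connected. $\delta^+(G)$, $\delta^-(G)$ are the minimum outdegree and minimum indegree, and $\delta^0(G)=\min\{\delta^+(G),\delta^-(G)\}$. $K(n,k,m)$ ($1\le m\le n-k-1$) is the digraph whose vertex set is partitioned into sets $S$, $V_1$, $V_2$ with $|S|=k$, $|V_1|=m$, $|V_2|=n-k-m$, and whose arcs are all ordered pairs $(u,v)$ of distinct vertices except those with $u\in V_2$ and $v\in V_1$. *)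

(* Defs.v *)
From mathcomp Require Import all_boot all_order all_algebra.
From mathcomp Require Import complex.
From mathcomp Require Import classical_sets reals.
Set Implicit Arguments.
Unset Strict Implicit.
Unset Printing Implicit Defensive.
Import Order.TTheory GRing.Theory Num.Theory.

Local Open Scope nat_scope.

Record digraph (V : finType) := Digraph {
  arc :> rel V;
  arc_irr : irreflexive arc
}.

Definition isomorphic (V W : finType) (G : digraph V) (H : digraph W) : Prop :=
  exists2 f : V -> W, bijective f & forall u v, arc H (f u) (f v) = arc G u v.

Section Digraph.

Variables (V : finType) (G : digraph V).

Definition arcs : {set V * V} := [set a | arc G a.1 a.2].

Definition strongly_connected : bool :=
  [forall u, forall v, connect (arc G) u v].

Definition outdeg (u : V) : nat := #|[set v | arc G u v]|.
Definition indeg (v : V) : nat := #|[set u | arc G u v]|.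

(* Every degree is less than #|V|, so the default value #|V| only matters
   when V is empty. *)
Definition min_outdeg : nat := \big[minn/#|V|]_(v : V) outdeg v.
Definition min_indeg : nat := \big[minn/#|V|]_(v : V) indeg v.
Definition min_semideg : nat := minn min_outdeg min_indeg.

Definition del_rel (F : {set V * V}) : rel V :=
  [rel u v | arc G u v && ((u, v) \notin F)].

Lemma del_rel_irr (F : {set V * V}) : irreflexive (del_rel F).
Proof. by move=> u; rewrite /del_rel /= arc_irr. Qed.

Definition del_arcs (F : {set V * V}) : digraph V := Digraph (del_rel_irr F).

End Digraph.

(* On at least two vertices, deleting all the arcs destroys strong
   connectivity, so the default value #|arcs G| is itself attained and does
   not affect the minimum. *)
Definition arc_connectivity (V : finType) (G : digraph V) : nat :=
  \big[minn/#|arcs G|]_(F : {set V * V} |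
      (F \subset arcs G) && ~~ strongly_connected (del_arcs G F)) #|F|.

Section DigraphK.

Variables n k m : nat.

(* S = {0, .., k-1}, V_1 = {k, .., k+m-1} and V_2 = {k+m, .., n-1}. *)
Definition K_V1 : {set 'I_n} := [set v : 'I_n | k <= v < k + m].
Definition K_V2 : {set 'I_n} := [set v : 'I_n | k + m <= v].

Definition K_rel : rel 'I_n :=
  [rel u v | (u != v) && ~~ ((u \in K_V2) && (v \in K_V1))].

Lemma K_rel_irr : irreflexive K_rel.
Proof. by move=> u; rewrite /K_rel /= eqxx. Qed.

Definition K : digraph 'I_n := Digraph K_rel_irr.

End DigraphK.

Local Open Scope ring_scope.
Local Open Scope complex_scope.

Section Spectral.

Variables (R : realType) (n : nat).

Definition adjacency (G : digraph 'I_n) : 'M[R]_n :=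
  \matrix_(i, j) (arc G i j)%:R.

Definition outdeg_mx (G : digraph 'I_n) : 'M[R]_n :=
  diag_mx (\row_i (outdeg G i)%:R).

Definition A_alpha (alpha : R) (G : digraph 'I_n) : 'M[R]_n :=
  alpha *: outdeg_mx G + (1 - alpha) *: adjacency G.

(* The set is finite, and nonempty when n > 0, so this supremum is a
   maximum. *)
Definition spectral_radius (M : 'M[R]_n) : R :=
  sup [set r : R | exists2 z : R[i],
    eigenvalue (map_mx (real_complex R) M) z & r%:C = `|z|]%classic.

Definition lambda_alpha (alpha : R) (G : digraph 'I_n) : R :=
  spectral_radius (A_alpha alpha G).

End Spectral.

(* Main.v *)
(** If [M >= 0] is irreducible, [y > 0] and [M y <= c y], then the spectral
    radius of [M] is at most [c], and it equals [c] only if [M y = c y]: pair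
    the inequality with the moduli of a left eigenvector. So only the two
    extremal digraphs need an explicit positive vector.

    A vertex of outdegree [k] embeds [G] in a copy of K(n,k,n-k-1), and one of
    indegree [k] embeds it in a copy of K(n,k,1). Let [lam] in
    (n - 2 + alpha, n - 1) be the Perron root of the 2 x 2 quotient of
    A_alpha(K(n,k,n-k-1)). The characteristic polynomial of the quotient of
    A_alpha(K(n,k,1)) takes at [lam] the value
    alpha (n - k - 2) (n - 1 - lam) >= 0, which yields a positive [y] with
    [A_alpha y <= lam y] there too, strictly in some coordinate unless
    alpha = 0 or n = k + 2; in the latter case the two digraphs coincide. *)
From mathcomp Require Import complex classical_sets reals.
From mathcomp Require Import all_boot all_order all_algebra all_fingroup.
From mathcomp Require Import ring lra zify.
Require Import Defs.
Set Implicit Arguments.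
Unset Strict Implicit.
Unset Printing Implicit Defensive.
Import Order.TTheory GRing.Theory Num.Theory.
Local Open Scope ring_scope.

(** * Nonnegative matrices with a positive vector [y] such that [N y <= c y] *)

Lemma sum_ge0_eq0 (R : numDomainType) (I : finType) (F : I -> R) :
  (forall i, 0 <= F i) -> \sum_i F i = 0 -> forall i, F i = 0.
Proof. by move=> F_ge0 F0 i; apply: (psumr_eq0P _ F0). Qed.

Section Perron.

Variables (C : numFieldType) (n : nat) (N : 'M[C]_n) (y : 'I_n -> C) (c : C).
Hypothesis N_ge0 : forall i j, 0 <= N i j.
Hypothesis y_gt0 : forall i, 0 < y i.
Hypothesis N_y : forall i, \sum_j N i j * y j <= c * y i.

Variables (z : C) (v : 'rV[C]_n).
Hypothesis v_neq0 : v != 0.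
Hypothesis vN : v *m N = z *: v.

Let norm_vN j : `|z| * `|v 0 j| <= \sum_i `|v 0 i| * N i j.
Proof.
have /rowP/(_ j) := vN; rewrite !mxE -normrM => <-.
apply: le_trans (ler_norm_sum _ _ _) _.
by apply: ler_sum => i _; rewrite normrM (ger0_norm (N_ge0 _ _)).
Qed.

Let v_y_gt0 : 0 < \sum_j `|v 0 j| * y j.
Proof.
have [j vj] : exists j, v 0 j != 0.
  by have [j] := rV0Pn _ v_neq0; exists j.
rewrite (bigD1 j) //= ltr_wpDr //; last by rewrite mulr_gt0 ?normr_gt0.
by apply: sumr_ge0 => i _; rewrite mulr_ge0 ?normr_ge0 // ltW.
Qed.

Let exchange : \sum_j (\sum_i `|v 0 i| * N i j) * y j =
               \sum_i `|v 0 i| * \sum_j N i j * y j.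
Proof.
under eq_bigr do rewrite mulr_suml.
rewrite exchange_big /=; apply: eq_bigr => i _.
by rewrite mulr_sumr; apply: eq_bigr => j _; rewrite mulrA.
Qed.

(** Pairing [|z| |v| <= |v| N] with [y], and [N y <= c y] with [|v|], bounds [|z|] times the pairing
    of [|v|] and [y] by [c] times it; this pairing is positive and cancels. *)
Lemma norm_eigenvalue_le : `|z| <= c.
Proof.
rewrite -(ler_pM2r v_y_gt0) !mulr_sumr.
apply: (@le_trans _ _ (\sum_j (\sum_i `|v 0 i| * N i j) * y j)).
  by apply: ler_sum => j _; rewrite mulrA ler_wpM2r // ltW.
rewrite exchange; apply: ler_sum => i _.
by rewrite mulrCA ler_wpM2l.
Qed.

(* Pairing [|z| |v| <= |v| N] with [y] and [N y <= c y] with [|v|] gives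
   equality everywhere; irreducibility then spreads the support of [|v|] to all
   indices. *)
Lemma norm_eigenvalue_eq :
  (forall i j, connect [rel i j | N i j != 0] i j) -> `|z| = c ->
  forall i, \sum_j N i j * y j = c * y i.
Proof.
move=> irrN zc.
pose w i := `|v 0 i|.
have w_ge0 i : 0 <= w i by exact: normr_ge0.
have left_ge0 j : 0 <= (\sum_i w i * N i j - c * w j) * y j.
  by rewrite mulr_ge0 ?(ltW (y_gt0 j)) // subr_ge0 -zc norm_vN.
have right_ge0 i : 0 <= w i * (c * y i - \sum_j N i j * y j).
  by rewrite mulr_ge0 // subr_ge0.
(* [|v| N y] and [c |v| y] occur with opposite signs in the two sums. Both sums are nonnegative, so
   they vanish term by term. *)
have sum0 : \sum_j (\sum_i w i * N i j - c * w j) * y j +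
            \sum_i w i * (c * y i - \sum_j N i j * y j) = 0.
  under eq_bigr do rewrite mulrBl.
  under [X in _ + X]eq_bigr do rewrite mulrBr.
  rewrite !sumrB exchange addrC subrKA.
  apply/eqP; rewrite subr_eq0; apply/eqP.
  by apply: eq_bigr => i _; rewrite mulrCA mulrA.
have /andP[/eqP left0 /eqP right0] :
    (\sum_j (\sum_i w i * N i j - c * w j) * y j == 0) &&
    (\sum_i w i * (c * y i - \sum_j N i j * y j) == 0).
  by rewrite -paddr_eq0 ?sum0 ?eqxx // sumr_ge0.
have wN j : c * w j = \sum_i w i * N i j.
  have /eqP := sum_ge0_eq0 left_ge0 left0 j.
  by rewrite mulf_eq0 (gt_eqF (y_gt0 j)) orbF subr_eq0 => /eqP.
(* If [w j = 0], the nonnegative terms [w i * N i j] sum to 0, so each of them vanishes. *)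
have w_step i j : N i j != 0 -> w i != 0 -> w j != 0.
  move=> Nij wi; apply: contra_neq Nij => wj.
  have /esym := wN j; rewrite wj mulr0 => sw0.
  have /eqP := sum_ge0_eq0 (fun i => mulr_ge0 (w_ge0 i) (N_ge0 i j)) sw0 i.
  by rewrite mulf_eq0 (negPf wi) => /eqP.
have [i0 vi0] := rV0Pn _ v_neq0.
have w_neq0 i : w i != 0.
  have /connectP[p] := irrN i0 i.
  have : w i0 != 0 by rewrite normr_eq0.
  elim: p i0 {vi0} => [|j p IH] i0 wi0 /= => [_ -> //|/andP[Ni0j]].
  by apply: IH; apply: w_step wi0.
move=> i.
have /eqP := sum_ge0_eq0 right_ge0 right0 i.
by rewrite mulf_eq0 (negPf (w_neq0 i)) subr_eq0 => /eqP.
Qed.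

End Perron.

(** * Right eigenvectors, and the spectral radius as an attained maximum *)

Lemma char_poly_trmx (R : comNzRingType) n (A : 'M[R]_n) :
  char_poly A^T = char_poly A.
Proof.
by rewrite /char_poly -det_tr /char_poly_mx linearB /= tr_scalar_mx map_trmx trmxK.
Qed.

(** [eigenvalue] refers to row eigenvectors; columns serve as well because a matrix and its
    transpose share their characteristic polynomial. *)
Lemma eigenvalue_col (F : fieldType) n (A : 'M[F]_n) (y : 'cV[F]_n) c :
  y != 0 -> A *m y = c *: y -> eigenvalue A c.
Proof.
move=> y0 Ay; rewrite eigenvalue_root_char -char_poly_trmx -eigenvalue_root_char.
apply/eigenvalueP; exists y^T; first by rewrite -trmx_mul Ay linearZ.
by rewrite -(inj_eq trmx_inj) trmxK linear0.
Qed.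

Section SpectralRadius.

Variables (R : realType) (n : nat) (M : 'M[R]_n).
Local Notation MC := (map_mx (real_complex R) M).

(** Over the closed field [R[i]] the eigenvalues form the finite list of roots of the characteristic
    polynomial, so the supremum is attained by an entry of largest modulus. *)
Lemma spectral_radiusP : (0 < n)%N ->
  (exists2 z, eigenvalue MC z & (spectral_radius M)%:C%C = `|z|) /\
  (forall z, eigenvalue MC z -> `|z| <= (spectral_radius M)%:C%C).
Proof.
move=> n_gt0.
have [s char_s] := closed_field_poly_normal (char_poly MC).
have eig_s z : eigenvalue MC z = (z \in s).
  rewrite eigenvalue_root_char char_s (monicP (char_poly_monic _)) scale1r.
  by rewrite root_prod_XsubC.
have [z0 z0s] : exists z0, z0 \in s.
  case: s char_s {eig_s} => [|z0 s _]; last by exists z0; rewrite mem_head.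
  (* Without roots the characteristic polynomial would be 1, of size 1 instead of [n.+1]. *)
  rewrite big_nil (monicP (char_poly_monic _)) scale1r => /(congr1 (size \o polyseq)).
  by rewrite /= size_char_poly size_poly1 => -[n0]; rewrite n0 in n_gt0.
pose E := [set r : R | exists2 z : R[i], eigenvalue MC z & r%:C%C = `|z|]%classic.
(* [Normc.normc] is the modulus with values in [R], where the order is total. *)
have [z1 z1s z1max] : exists2 z1, z1 \in s &
    {in s, forall z, Normc.normc z <= Normc.normc z1}.
  elim: s z0 z0s {char_s eig_s} => // a s IH z0 _.
  have [->|[b bs]] : s = [::] \/ exists b, b \in s.
    by case: (s) => [|b ?]; [left|right; exists b; rewrite mem_head].
  - by exists a; rewrite ?mem_head // => z; rewrite inE => /eqP->.
  have [z1 z1s z1max] := IH b bs.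
  have [le_a|/ltW le_a] := leP (Normc.normc a) (Normc.normc z1).
    exists z1; first by rewrite inE z1s orbT.
    by move=> z; rewrite inE => /predU1P[->//|/z1max].
  exists a; first exact: mem_head.
  move=> z; rewrite inE => /predU1P[->//|/z1max le_z]; exact: le_trans le_a.
have E1 : E (Normc.normc z1) by exists z1; rewrite ?eig_s.
have ubE : ubound E (Normc.normc z1).
  by move=> r [z]; rewrite eig_s => /z1max le_z [->].
have -> : spectral_radius M = Normc.normc z1.
  apply/eqP; rewrite eq_le ge_sup //=; last by exists (Normc.normc z1).
  by apply: ub_le_sup => //; exists (Normc.normc z1).
split; first by exists z1; rewrite ?eig_s.
by move=> z; rewrite eig_s => /z1max; rewrite -lecR.
Qed.

End SpectralRadius.

(** * Comparison of [lambda_alpha] through positive test vectors *)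

Section LambdaBound.

Variables (R : realType) (n : nat) (alpha : R).
Hypothesis alpha01 : 0 <= alpha < 1.

(** Row [i] of [A_alpha] applied to [y], with the diagonal entry shared out as one [alpha * y i] per
    out-neighbour. For positive [y] every term is positive, so the sum grows with [e]. *)
Definition alpha_op (e : rel 'I_n) (y : 'I_n -> R) (i : 'I_n) : R :=
  \sum_(j | e i j) (alpha * y i + (1 - alpha) * y j).

Lemma A_alpha_op (G : digraph 'I_n) y i :
  \sum_j A_alpha alpha G i j * y j = alpha_op G y i.
Proof.
under eq_bigr do rewrite !mxE mulrDl.
rewrite big_split /= (bigD1 i) //= eqxx big1 => [|j jDi]; last first.
  by rewrite eq_sym (negPf jDi) mulr0 mul0r.
rewrite mulr1n addr0 /alpha_op big_split /=; congr (_ + _).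
  by rewrite sumr_const /outdeg cardsE -mulr_natr; ring.
by rewrite [RHS]big_mkcond; apply: eq_bigr => j _; case: (arc G i j); rewrite ?mulr1 ?mulr0 ?mul0r.
Qed.

Let MC (G : digraph 'I_n) := map_mx (real_complex R) (A_alpha alpha G).

Let MC_ge0 G i j : 0 <= MC G i j.
Proof.
have /andP[a0 a1] := alpha01.
rewrite !mxE (_ : 0 = 0%:C%C) // lecR.
by rewrite addr_ge0 // mulr_ge0 ?mulrn_wge0 ?ler0n // subr_ge0 ltW.
Qed.

Let MC_op G y i : \sum_j MC G i j * (y j)%:C%C = (alpha_op G y i)%:C%C.
Proof.
rewrite -A_alpha_op rmorph_sum; apply: eq_bigr => j _.
by rewrite mxE -rmorphM.
Qed.

Lemma lambda_alpha_le (G : digraph 'I_n) (y : 'I_n -> R) c : (0 < n)%N ->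
  (forall i, 0 < y i) -> (forall i, alpha_op G y i <= c * y i) ->
  lambda_alpha alpha G <= c.
Proof.
move=> n_gt0 y_gt0 Gy.
have [[z /eigenvalueP[v vN v0] zE] _] := spectral_radiusP (A_alpha alpha G) n_gt0.
rewrite -lecR zE.
apply: (norm_eigenvalue_le (MC_ge0 G) (y := fun i => (y i)%:C%C) _ _ v0 vN).
  by move=> i; rewrite (_ : 0 = 0%:C%C) // ltcR.
by move=> i; rewrite MC_op -rmorphM lecR.
Qed.

(** [y] is a right eigenvector, so [c] is itself an eigenvalue and the upper bound is attained. *)
Lemma lambda_alpha_eq (G : digraph 'I_n) (y : 'I_n -> R) c : (0 < n)%N ->
  (forall i, 0 < y i) -> (forall i, alpha_op G y i = c * y i) ->
  lambda_alpha alpha G = c.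
Proof.
move=> n_gt0 y_gt0 Gy; apply/eqP; rewrite eq_le; apply/andP; split.
  by apply: (lambda_alpha_le n_gt0 y_gt0) => i; rewrite Gy.
have [_ ub] := spectral_radiusP (A_alpha alpha G) n_gt0.
rewrite -lecR; apply: le_trans (ub c%:C%C _).
  by rewrite (_ : `|_| = `|c|%:C%C) ?lecR ?ler_norm // normc_def /= expr0n addr0 sqrtr_sqr.
apply: (@eigenvalue_col _ _ _ (\col_i (y i)%:C%C)).
  apply/eqP => /colP/(_ (Ordinal n_gt0)); rewrite !mxE => -[] y0.
  by have := y_gt0 (Ordinal n_gt0); rewrite y0 ltxx.
apply/colP => i; rewrite !mxE; transitivity (alpha_op G y i)%:C%C.
  by rewrite -MC_op; apply: eq_bigr => j _; rewrite !mxE.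
by rewrite Gy rmorphM.
Qed.

(** Passing from [e] to [G] only drops positive terms, so the bound by [y] persists. If it is
    attained, irreducibility makes [y] an eigenvector for [G], and no term can have been dropped. *)
Lemma lambda_alpha_extremal (G : digraph 'I_n) (e : rel 'I_n) (y : 'I_n -> R) c :
  (0 < n)%N -> strongly_connected G -> subrel G e ->
  (forall i, 0 < y i) -> (forall i, alpha_op e y i <= c * y i) ->
  lambda_alpha alpha G <= c /\
  (lambda_alpha alpha G = c ->
     (forall i j, arc G i j = e i j) /\ forall i, alpha_op e y i = c * y i).
Proof.
move=> n_gt0 sG Ge y_gt0 ey.
have /andP[a0 a1] := alpha01.
have term_gt0 i j : 0 < alpha * y i + (1 - alpha) * y j.
  by rewrite ltr_wpDl ?mulr_ge0 ?mulr_gt0 ?subr_gt0 // ltW.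
have opE i : alpha_op e y i = alpha_op G y i +
    \sum_(j | e i j && ~~ arc G i j) (alpha * y i + (1 - alpha) * y j).
  rewrite /alpha_op (bigID (arc G i)) /=; congr (_ + _).
  by apply: eq_bigl => j; case: (boolP (arc G i j)) => [/Ge->|_]; rewrite ?andbF.
have rest_ge0 i : 0 <= \sum_(j | e i j && ~~ arc G i j) (alpha * y i + (1 - alpha) * y j).
  by apply: sumr_ge0 => j _; apply: ltW.
have Gy i : alpha_op G y i <= c * y i.
  by apply: le_trans (ey i); rewrite opE lerDl.
split; first exact: lambda_alpha_le Gy.
move=> lamc.
have [[z /eigenvalueP[v vN v0] zE] _] := spectral_radiusP (A_alpha alpha G) n_gt0.
have GyE i : alpha_op G y i = c * y i.
  suff : (alpha_op G y i)%:C%C = (c * y i)%:C%C by move=> [].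
  rewrite -MC_op rmorphM /=.
  move: i; apply: (norm_eigenvalue_eq (MC_ge0 G) (y := fun i => (y i)%:C%C) _ _ v0 vN).
  - by move=> i; rewrite (_ : 0 = 0%:C%C) // ltcR.
  - by move=> i; rewrite MC_op -rmorphM lecR.
  (* An arc gives an off-diagonal entry [1 - alpha > 0], so strong connectivity yields
     irreducibility. *)
  - move=> i j; have /forallP/(_ i)/forallP/(_ j) := sG.
    apply: connect_sub => u w Guw; apply: connect1 => /=.
    have uw : u != w by apply: contraTneq Guw => ->; rewrite arc_irr.
    rewrite !mxE (negPf uw) Guw mulr0 add0r mulr1.
    by rewrite (_ : 0 = 0%:C%C) // (inj_eq (@complexI _)) gt_eqF // subr_gt0.
  - by rewrite -zE -lamc.
have eyE i : alpha_op e y i = c * y i.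
  by apply/eqP; rewrite eq_le ey -GyE opE lerDl rest_ge0.
split=> // i j; apply/idP/idP => [/Ge//|eij]; apply/negPn/negP => nGij.
(* The missing arc would contribute a positive term to the difference of two equal sums. *)
have := opE i; rewrite eyE -GyE (bigD1 j) /= ?eij //= => /eqP.
rewrite -subr_eq0 opprD addrA subrr add0r oppr_eq0 gt_eqF //.
by rewrite ltr_wpDr // sumr_ge0 // => k _; apply: ltW.
Qed.

End LambdaBound.

(** * The extremal digraphs up to isomorphism *)

Section Extremal.

Variable n : nat.
Implicit Types (v : 'I_n) (S : {set 'I_n}) (G H : digraph 'I_n).

(* [out_complete v S] is K(n,k,n-k-1) with [V_2 = {v}], and [in_complete v S]
   is K(n,k,1) with [V_1 = {v}], where [k = #|S|]. *)
Definition out_complete v S : rel 'I_n :=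
  [rel u w | (u != w) && ((u == v) ==> (w \in S))].

Definition in_complete v S : rel 'I_n := [rel u w | out_complete v S w u].

Lemma out_completeE v S u w :
  out_complete v S u w = (u != w) && ((u == v) ==> (w \in S)).
Proof. by []. Qed.

Lemma in_completeE v S u w :
  in_complete v S u w = (w != u) && ((w == v) ==> (u \in S)).
Proof. by []. Qed.

Definition out_extremal k G := exists v S,
  [/\ v \notin S, #|S| = k & forall u w, arc G u w = out_complete v S u w].

Definition in_extremal k G := exists v S,
  [/\ v \notin S, #|S| = k & forall u w, arc G u w = in_complete v S u w].

(** Equal fibre sizes mean that the two tuples of values have the same multiplicities, hence are
    permutations of each other. *)
Lemma perm_of_fibers (c c' : 'I_n -> nat) :
  (forall j, #|[set i | c i == j]| = #|[set i | c' i == j]|) ->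
  exists p : {perm 'I_n}, forall i, c i = c' (p i).
Proof.
move=> cc'.
have count_codom (d : 'I_n -> nat) j :
    count_mem j [tuple d i | i < n] = #|[set i | d i == j]|.
  by rewrite cardsE cardE /= count_map enumT /enum_mem size_filter.
have /tuple_permP[p /val_inj cp] : perm_eq [tuple c i | i < n] [tuple c' i | i < n].
  by apply/allP => j _ /=; rewrite !count_codom cc'.
exists p => i; have /(congr1 (fun t => tnth t i)) := cp.
by rewrite !tnth_mktuple.
Qed.

Lemma perm_of_pointed_sets v v' S S' :
  v \notin S -> v' \notin S' -> #|S| = #|S'| ->
  exists p : {perm 'I_n}, forall i, (i == v) = (p i == v') /\ (i \in S) = (p i \in S').
Proof.
move=> vS vS' SS'.
(* Three colours separate the point, the set and the remaining vertices; a permutation matching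
   colours matches both data. *)
pose col x (A : {set 'I_n}) (i : 'I_n) := if i == x then 0%N else if i \in A then 1%N else 2%N.
have col0 x A : [set i | col x A i == 0%N] = [set x].
  by apply/setP => i; rewrite !inE /col; case: (i == x); case: (i \in A).
have col1 x (A : {set 'I_n}) : x \notin A -> [set i | col x A i == 1%N] = A.
  move=> xA; apply/setP => i; rewrite !inE /col; case: (eqVneq i x) => [->|_].
    by rewrite (negPf xA).
  by case: (i \in A).
have col2 x A : [set i | col x A i == 2%N] = ~: (x |: A).
  by apply/setP => i; rewrite !inE /col; case: (i == x); case: (i \in A).
have col3 x A j : [set i | col x A i == j.+3] = set0.
  by apply/setP => i; rewrite !inE /col; case: (i == x); case: (i \in A).
have [p colp] : exists p : {perm 'I_n}, forall i, col v S i = col v' S' (p i).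
  apply: perm_of_fibers => -[|[|[|j]]].
  - by rewrite !col0 !cards1.
  - by rewrite !col1.
  - by rewrite !col2 cardsCs [RHS]cardsCs !setCK !cardsU1 vS vS' SS'.
  - by rewrite !col3.
exists p => i; have := colp i; rewrite /col.
case: (eqVneq i v) => [->|_]; case: (eqVneq (p _) v') => [->|_];
  rewrite ?(negPf vS) ?(negPf vS') //.
- by case: (_ \in _).
- by case: (_ \in _).
by case: (_ \in _); case: (_ \in _).
Qed.

(** The arcs depend only on the pair of [v] and [S]: an isomorphism pulls this pair back, and pairs
    of equal size are matched by a permutation. *)
Lemma out_extremal_isomorphic k G H :
  out_extremal k H -> (isomorphic G H <-> out_extremal k G).
Proof.
move=> [v [S [vS Sk HE]]]; split=> [[f fbij fE]|[v' [S' [vS' Sk' GE]]]].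
  have [g fK gK] := fbij; exists (g v), (f @^-1: S); split.
  - by rewrite inE gK.
  - by rewrite on_card_preimset //; apply: onW_bij.
  move=> u w; rewrite -fE HE !out_completeE inE (inj_eq (bij_inj fbij)).
  by rewrite -{1}(gK v) (inj_eq (bij_inj fbij)).
have [|p pE] := perm_of_pointed_sets vS' vS; first by rewrite Sk.
exists p; first by exists (p^-1)%g; [exact: permK|exact: permKV].
move=> u w; rewrite HE GE !out_completeE (inj_eq perm_inj).
by have [<- _] := pE u; have [_ <-] := pE w.
Qed.

Lemma in_extremal_isomorphic k G H :
  in_extremal k H -> (isomorphic G H <-> in_extremal k G).
Proof.
move=> [v [S [vS Sk HE]]]; split=> [[f fbij fE]|[v' [S' [vS' Sk' GE]]]].
  have [g fK gK] := fbij; exists (g v), (f @^-1: S); split.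
  - by rewrite inE gK.
  - by rewrite on_card_preimset //; apply: onW_bij.
  move=> u w; rewrite -fE HE !in_completeE inE (inj_eq (bij_inj fbij)).
  by rewrite -{1}(gK v) (inj_eq (bij_inj fbij)).
have [|p pE] := perm_of_pointed_sets vS' vS; first by rewrite Sk.
exists p; first by exists (p^-1)%g; [exact: permK|exact: permKV].
move=> u w; rewrite HE GE !in_completeE (inj_eq perm_inj).
by have [<- _] := pE w; have [_ <-] := pE u.
Qed.

Lemma card_ord_lt k : (k <= n)%N -> #|[set i : 'I_n | (i < k)%N]| = k.
Proof.
move=> kn; rewrite -sum1_card -{2}(card_ord k) -sum1_card.
by rewrite (big_ord_widen _ (fun=> 1%N) kn); apply: eq_bigl => i; rewrite inE.
Qed.

Lemma K_out_extremal k : (k + 2 <= n)%N -> out_extremal k (K n k (n - k - 1)).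
Proof.
move=> kn.
(* For [m = n - k - 1], [V_2] is the last vertex alone, with out-neighbourhood [S]. *)
have n1 : (n.-1 < n)%N by lia.
exists (Ordinal n1), [set i : 'I_n | (i < k)%N]; split.
- by rewrite inE /=; lia.
- by apply: card_ord_lt; lia.
move=> u w; rewrite out_completeE /= /K_rel /= !inE -(inj_eq val_inj u (Ordinal n1)) /=.
have := ltn_ord u; have := ltn_ord w.
case: eqVneq => //= uw; have {uw} : u != w :> nat by [].
by lia.
Qed.

Lemma K_in_extremal k : (k + 2 <= n)%N -> in_extremal k (K n k 1).
Proof.
move=> kn.
(* For [m = 1], [V_1] is the vertex [k] alone, with in-neighbourhood [S]. *)
have kn' : (k < n)%N by lia.
exists (Ordinal kn'), [set i : 'I_n | (i < k)%N]; split.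
- by rewrite inE /=; lia.
- by apply: card_ord_lt; lia.
move=> u w; rewrite in_completeE /= /K_rel /= !inE -(inj_eq val_inj w (Ordinal kn')) /= eq_sym.
have := ltn_ord u; have := ltn_ord w.
case: eqVneq => //= uw; have {uw} : w != u :> nat by [].
by lia.
Qed.

End Extremal.

(** * Test vectors obtained from the quotient matrices *)

Section Eigenvectors.

Variables (R : realType) (n k : nat) (alpha lam : R).
Hypothesis (k_gt0 : (0 < k)%N) (kn : (k + 2 <= n)%N).
Hypothesis alpha01 : 0 <= alpha < 1.

Local Notation nR := (n%:R : R).
Local Notation kR := (k%:R : R).

(* [lam] is the largest root of the characteristic polynomial of the quotient
   matrix [n-2+alpha, 1-alpha; (1-alpha)k, alpha k] of A_alpha(K(n,k,n-k-1)). *)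
Definition extremal_root :=
  nR - 2 + alpha < lam < nR - 1 /\
  (lam - (nR - 2 + alpha)) * (lam - alpha * kR) = (1 - alpha) ^+ 2 * kR.

Hypothesis lamP : extremal_root.

Let kR_ge1 : 1 <= kR. Proof. by rewrite ler1n. Qed.
Let knR : kR + 2 <= nR. Proof. by rewrite -natrD ler_nat. Qed.

Let cokR_gt0 : 0 < (1 - alpha) * kR.
Proof. by have /andP[a0 a1] := alpha01; rewrite mulr_gt0 ?subr_gt0 ?ltr0n. Qed.

Variables (v : 'I_n) (S : {set 'I_n}).
Hypotheses (vS : v \notin S) (cardS : #|S| = k).

Let sum_if (A : {set 'I_n}) (a b : R) :
  \sum_i (if i \in A then a else b) = b * nR + (a - b) * #|A|%:R.
Proof.
rewrite (eq_bigr (fun i => b + (if i \in A then a - b else 0))); last first.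
  by move=> i _; case: ifP => _; ring.
rewrite big_split /= sumr_const card_ord mulr_natr; congr (_ + _).
by rewrite mulr_natr -sumr_const [RHS]big_mkcond.
Qed.

Let sum_row (y : 'I_n -> R) (i : 'I_n) :
  \sum_(j | j != i) (alpha * y i + (1 - alpha) * y j) =
  alpha * y i * nR + (1 - alpha) * (\sum_j y j) - y i.
Proof.
have : \sum_j (alpha * y i + (1 - alpha) * y j) =
       alpha * y i * nR + (1 - alpha) * \sum_j y j.
  by rewrite big_split /= sumr_const card_ord -mulr_sumr mulr_natr.
rewrite (bigD1 i) //= => sumE.
by apply: (addrI (alpha * y i + (1 - alpha) * y i)); rewrite sumE; ring.
Qed.

(** The two values solve the quotient equation at [v]. *)
Definition out_vec (i : 'I_n) : R :=
  if i \in [set v] then (1 - alpha) * kR else lam - alpha * kR.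

(** The two values solve the quotient equation outside [v |: S], leaving any defect to the rows in
    [v |: S]. *)
Definition in_vec (i : 'I_n) : R :=
  if i \in v |: S then lam - (alpha * (nR - 2) + (1 - alpha) * (nR - kR - 2))
  else (1 - alpha) * kR.

Lemma out_vec_gt0 i : 0 < out_vec i.
Proof.
have /andP[a0 a1] := alpha01; have [/andP[l1 l2] _] := lamP.
rewrite /out_vec; case: ifP => _ //.
by move: cokR_gt0 knR; lra.
Qed.

Lemma in_vec_gt0 i : 0 < in_vec i.
Proof.
have /andP[a0 a1] := alpha01; have [/andP[l1 l2] _] := lamP.
rewrite /in_vec; case: ifP => _ //.
by move: cokR_gt0 knR; lra.
Qed.

(** At [v] this holds by the choice of the values; elsewhere it is the characteristic equation of
    [lam]. *)
Lemma out_vec_eigen i :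
  alpha_op alpha (out_complete v S) out_vec i = lam * out_vec i.
Proof.
have [_ lamE] := lamP; rewrite /alpha_op.
have [->|iv] := eqVneq i v.
  rewrite (eq_bigl (mem S)) => [|j]; last first.
    by rewrite out_completeE eqxx /=; case: eqVneq => [<-|//]; rewrite (negPf vS).
  rewrite (eq_bigr (fun=> alpha * out_vec v + (1 - alpha) * (lam - alpha * kR))); last first.
    move=> j jS; have jv : j != v by apply: contraNneq vS => <-.
    by rewrite /out_vec !inE !eqxx (negPf jv).
  rewrite sumr_const cardS -[X in X = _]mulr_natr /out_vec !inE eqxx; ring.
rewrite (eq_bigl (fun j => j != i)) => [|j]; last first.
  by rewrite out_completeE (negPf iv) andbT eq_sym.
rewrite sum_row sum_if cards1 /out_vec !inE (negPf iv).
have : lam * (lam - alpha * kR) =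
  (nR - 2 + alpha) * (lam - alpha * kR) + (1 - alpha) ^+ 2 * kR by rewrite -lamE; ring.
by move=> ->; ring.
Qed.

(* The defect is the value at [lam] of the characteristic polynomial of the
   quotient matrix of K(n,k,1). *)
Lemma in_vec_op i :
  alpha_op alpha (in_complete v S) in_vec i = lam * in_vec i -
    (if i \in v |: S then alpha * (nR - kR - 2) * (nR - 1 - lam) else 0).
Proof.
have [_ lamE] := lamP; rewrite /alpha_op.
have cardA : #|v |: S|%:R = kR + 1 by rewrite cardsU1 vS cardS natrD addrC.
have [iA|iA] := boolP (i \in v |: S).
  rewrite (eq_bigl (fun j => j != i)) => [|j]; last first.
    rewrite in_completeE; case: eqVneq => //= jDi; apply/implyP => /eqP jv.
    by move: iA; rewrite !inE -jv eq_sym (negPf jDi).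
  rewrite sum_row sum_if cardA /in_vec iA.
  have : lam ^+ 2 = lam * (nR - 2 + alpha + alpha * kR)
     - (nR - 2 + alpha) * alpha * kR + (1 - alpha) ^+ 2 * kR by rewrite -lamE; ring.
  by move=> lam2; ring: lam2.
have iv : v != i by apply: contraNneq iA => ->; rewrite !inE eqxx.
(* From [i] only the arc to [v] is missing, so the row is the full sum minus its term at [v]. *)
have := sum_row in_vec i; rewrite (bigD1 v) //= sum_if cardA.
rewrite (eq_bigl (in_complete v S i)) => [|j]; last first.
  rewrite in_completeE; case: eqVneq => //= jDi; case: eqVneq => //= _.
  by move: iA; rewrite !inE negb_or => /andP[_ /negPf->].
rewrite /in_vec (negPf iA) !inE eqxx /= => h.
rewrite subr0; apply: (addrI (alpha * ((1 - alpha) * kR) +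
   (1 - alpha) * (lam - (alpha * (nR - 2) + (1 - alpha) * (nR - kR - 2))))).
by rewrite h; ring.
Qed.

End Eigenvectors.

(** Intermediate value theorem: the polynomial is [- (1 - alpha) ^+ 2 * k < 0] at [n - 2 + alpha]
    and [(1 - alpha) * (n - 1 - k) > 0] at [n - 1]. *)
Lemma extremal_root_exists (R : realType) n k (alpha : R) :
  (0 < k)%N -> (k + 2 <= n)%N -> 0 <= alpha < 1 ->
  exists lam, extremal_root n k alpha lam.
Proof.
move=> k_gt0 kn /andP[a0 a1].
have k1 : 1 <= k%:R :> R by rewrite ler1n.
have knR : k%:R + 2 <= n%:R :> R by rewrite -natrD ler_nat.
pose p : {poly R} := ('X - (n%:R - 2 + alpha)%:P) * ('X - (alpha * k%:R)%:P)
   - ((1 - alpha) ^+ 2 * k%:R)%:P.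
have pE x : p.[x] = (x - (n%:R - 2 + alpha)) * (x - alpha * k%:R) -
                    (1 - alpha) ^+ 2 * k%:R by rewrite /p !hornerE.
have lo : p.[n%:R - 2 + alpha] < 0.
  rewrite pE subrr mul0r sub0r oppr_lt0 mulr_gt0 ?exprn_gt0 ?subr_gt0 //; lra.
have hi : 0 < p.[n%:R - 1].
  rewrite pE (_ : _ - _ = (1 - alpha) * (n%:R - 1 - k%:R)); last by ring.
  by rewrite mulr_gt0 //; lra.
have [||lam /andP[l1 l2] /rootP lam0] := @poly_ivt _ p (n%:R - 2 + alpha) (n%:R - 1).
- by lra.
- by rewrite !ltW.
exists lam; split; last by apply/eqP; rewrite -subr_eq0 -pE lam0.
rewrite !lt_neqAle l1 l2 !andbT; apply/andP; split.
  by apply: contraTneq lo => ->; rewrite lam0 ltxx.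
by apply: contraTneq hi => <-; rewrite lam0 ltxx.
Qed.

(** * Vertices of minimum degree, and the comparison of [G] with the extremal digraphs *)

Lemma bigminn_attained (I : finType) d (F : I -> nat) :
  \big[minn/d]_i F i = d \/ exists i, \big[minn/d]_i F i = F i.
Proof.
elim/big_ind: _ => [|x y xP yP|i _]; [by left| |by right; exists i].
by rewrite /minn; case: ifP.
Qed.

(** The bound by [n] excludes the default value of the two minima. *)
Lemma min_semideg_attained n (G : digraph 'I_n) : (min_semideg G < n)%N ->
  (exists v, outdeg G v = min_semideg G) \/ (exists v, indeg G v = min_semideg G).
Proof.
have [->|->] : min_semideg G = min_outdeg G \/ min_semideg G = min_indeg G.
  by rewrite /min_semideg /minn; case: ifP; [left|right].
- rewrite /min_outdeg; have [->|[v vE]] := bigminn_attained #|'I_n| (outdeg G).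
    by rewrite card_ord ltnn.
  by left; exists v; rewrite vE.
rewrite /min_indeg; have [->|[v vE]] := bigminn_attained #|'I_n| (indeg G).
  by rewrite card_ord ltnn.
by right; exists v; rewrite vE.
Qed.

Section ExtremalLambda.

Variables (R : realType) (n k : nat) (alpha lam : R) (G : digraph 'I_n).
Hypotheses (k_gt0 : (0 < k)%N) (kn : (k + 2 <= n)%N).
Hypotheses (alpha01 : 0 <= alpha < 1) (lamP : extremal_root n k alpha lam).

Let n_gt0 : (0 < n)%N. Proof. by lia. Qed.

Lemma lambda_alpha_out_extremal : out_extremal k G -> lambda_alpha alpha G = lam.
Proof.
move=> [v [S [vS Sk GE]]].
apply: (lambda_alpha_eq alpha01 n_gt0 (out_vec_gt0 k_gt0 kn alpha01 lamP v)) => i.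
rewrite -(out_vec_eigen lamP vS Sk) /alpha_op.
by apply: eq_bigl => j; apply: GE.
Qed.

(** The defect of [in_vec] carries a factor [alpha], so [in_vec] is an eigenvector here. *)
Lemma lambda_0_in_extremal :
  alpha = 0 -> in_extremal k G -> lambda_alpha alpha G = lam.
Proof.
move=> a0 [v [S [vS Sk GE]]].
apply: (lambda_alpha_eq alpha01 n_gt0 (in_vec_gt0 k_gt0 kn alpha01 lamP v S)) => i.
transitivity (alpha_op alpha (in_complete v S) (in_vec k alpha lam v S) i).
  by apply: eq_bigl => j; apply: GE.
by rewrite (in_vec_op lamP vS Sk) a0 !mul0r if_same subr0.
Qed.

Hypothesis sG : strongly_connected G.

(** With [S] the out-neighbourhood of [v], [out_complete v S] adds to [G] all missing arcs that do
    not leave [v]. *)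
Lemma lambda_alpha_outdeg v : outdeg G v = k ->
  lambda_alpha alpha G <= lam /\ (lambda_alpha alpha G = lam -> out_extremal k G).
Proof.
move=> Gv; pose S := [set w | arc G v w].
have vS : v \notin S by rewrite inE arc_irr.
have [|||le_lam eq_lam] := lambda_alpha_extremal alpha01 (G := G)
  (e := out_complete v S) (y := out_vec k alpha lam v) (c := lam) n_gt0 sG.
- move=> u w Guw; rewrite out_completeE inE; apply/andP; split.
    by apply: contraTneq Guw => ->; rewrite arc_irr.
  by apply/implyP => /eqP <-.
- exact: out_vec_gt0.
- by move=> i; rewrite out_vec_eigen.
split=> // /eq_lam[GE _]; by exists v, S.
Qed.

(** Equality forces the defect [alpha * (n - k - 2) * (n - 1 - lam)] at [v] to vanish; as
    [lam < n - 1], a positive [alpha] leaves only [n = k + 2]. *)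
Lemma lambda_alpha_indeg v : indeg G v = k ->
  lambda_alpha alpha G <= lam /\
  (lambda_alpha alpha G = lam ->
     in_extremal k G /\ (0 < alpha -> n = (k + 2)%N)).
Proof.
move=> Gv; pose S := [set u | arc G u v].
have vS : v \notin S by rewrite inE arc_irr.
have [/andP[_ lam_lt] _] := lamP.
have [a0 _] := andP alpha01.
have gap_ge0 : 0 <= n%:R - k%:R - 2 :> R.
  by rewrite -addrA -opprD subr_ge0 -natrD ler_nat.
have [|||le_lam eq_lam] := lambda_alpha_extremal alpha01 (G := G)
  (e := in_complete v S) (y := in_vec k alpha lam v S) (c := lam) n_gt0 sG.
- move=> u w Guw; rewrite in_completeE inE; apply/andP; split.
    by apply: contraTneq Guw => ->; rewrite arc_irr.
  by apply/implyP => /eqP <-.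
- exact: in_vec_gt0.
- move=> i; rewrite in_vec_op // lerBlDr lerDl.
  by case: ifP => // _; rewrite !mulr_ge0 // subr_ge0 ltW.
split=> // /eq_lam[GE eqv]; split; first by exists v, S.
move=> a_gt0; have := eqv v; rewrite in_vec_op // !inE eqxx /= => /eqP.
rewrite -subr_eq0 addrC addKr oppr_eq0 !mulf_eq0 (gt_eqF a_gt0) /=.
rewrite [X in _ || X]subr_eq0 (gt_eqF lam_lt) orbF.
by rewrite -addrA -opprD subr_eq0 -natrD eqr_nat => /eqP.
Qed.

End ExtremalLambda.

Theorem theorem6p1 (R : realType) (alpha : R) (n k : nat) (G : digraph 'I_n)
    (hk : (1 <= k <= n - 2)%N)
    (hG : strongly_connected G)
    (hconn : arc_connectivity G = k)
    (hdeg : min_semideg G = k) :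
  (alpha = 0 ->
    [/\ lambda_alpha alpha G <= lambda_alpha alpha (K n k 1),
        lambda_alpha alpha (K n k 1) = lambda_alpha alpha (K n k (n - k - 1)%N) &
        lambda_alpha alpha G = lambda_alpha alpha (K n k 1) <->
          isomorphic G (K n k (n - k - 1)%N) \/ isomorphic G (K n k 1)]) /\
  (0 < alpha < 1 ->
    lambda_alpha alpha G <= lambda_alpha alpha (K n k (n - k - 1)%N) /\
    (lambda_alpha alpha G = lambda_alpha alpha (K n k (n - k - 1)%N) <->
       isomorphic G (K n k (n - k - 1)%N))).
Proof.
have k_gt0 : (0 < k)%N by lia.
have kn : (k + 2 <= n)%N by lia.
have Kout := K_out_extremal kn; have Kin := K_in_extremal kn.
have iso_out := out_extremal_isomorphic G Kout.
have iso_in := in_extremal_isomorphic G Kin.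
have degP : (exists v, outdeg G v = k) \/ (exists v, indeg G v = k).
  by rewrite -hdeg; apply: min_semideg_attained; rewrite hdeg; lia.
split=> [alpha0|/andP[a_gt0 a_lt1]].
  have alpha01 : 0 <= alpha < 1 by rewrite alpha0 lexx ltr01.
  have [lam lamP] := extremal_root_exists k_gt0 kn alpha01.
  rewrite (lambda_alpha_out_extremal k_gt0 kn alpha01 lamP Kout).
  rewrite (lambda_0_in_extremal k_gt0 kn alpha01 lamP alpha0 Kin).
  have back : isomorphic G (K n k (n - k - 1)%N) \/ isomorphic G (K n k 1) ->
      lambda_alpha alpha G = lam.
    case=> [/iso_out|/iso_in]; first exact: lambda_alpha_out_extremal.
    exact: lambda_0_in_extremal.
  case: degP => -[v Gv].
    have [le_lam eq_lam] := lambda_alpha_outdeg k_gt0 kn alpha01 lamP hG Gv.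
    by split=> //; split=> // /eq_lam /iso_out; left.
  have [le_lam eq_lam] := lambda_alpha_indeg k_gt0 kn alpha01 lamP hG Gv.
  by split=> //; split=> // /eq_lam[/iso_in iso _]; right.
have alpha01 : 0 <= alpha < 1 by rewrite ltW.
have [lam lamP] := extremal_root_exists k_gt0 kn alpha01.
rewrite (lambda_alpha_out_extremal k_gt0 kn alpha01 lamP Kout).
have back : isomorphic G (K n k (n - k - 1)%N) -> lambda_alpha alpha G = lam.
  by move=> /iso_out; apply: lambda_alpha_out_extremal.
case: degP => -[v Gv].
  have [le_lam eq_lam] := lambda_alpha_outdeg k_gt0 kn alpha01 lamP hG Gv.
  by split=> //; split=> // /eq_lam /iso_out.
have [le_lam eq_lam] := lambda_alpha_indeg k_gt0 kn alpha01 lamP hG Gv.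
split=> //; split=> // /eq_lam[/iso_in iso /(_ a_gt0) nE].
(* As [n = k + 2], the two extremal digraphs coincide. *)
by have -> : (n - k - 1)%N = 1%N by lia.
Qed.
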